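(* Let $d\ge2$ and let $i,j$ be nonnegative integers with $j<d-1$ such that either $(i,j)=(0,0)$, or $i\ge1$ and $i+j\le d-1$. Define $$f_d(i,j,x)=\sum_{k=0}^{d-1} C_{d-1-k}(1-x)^kx^{d-k}\sum_{s=0}^{j}\binom{j}{s}\binom{d+i+j-1-k-s}{k-s},\qquad C_n=\tfrac1{n+1}\tbinom{2n}{n}.$$ Then for every $m$, the coefficient of $x^{d-m}$ in $f_d(i,j,x)$ equals the number of noncrossing partitions of $\{1,2,\ldots,d-1\}$ having exactly $m$ elements $v$ with one of the following properties: $v$ is the minimum element of a block with at least two elements; $\{v\}$ is a singleton block and $v\le i$ or $v\ge d-j$; $v\ge d-j$, $v$ is not the minimum element of its block, and if $v$ is the maximum element of its block then that block contains $1$.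
   Context: A partition of $\{1,\ldots,n\}$ is noncrossing if whenever $a<b<c<e$ with $a,c$ in one block and $b,e$ in one block, all four lie in the same block. ($f_d(i,j,x)$ is the contribution of a shelling component of type $(i,j)$ to the toric $f$-polynomial of a shellable $(d-1)$-dimensional cubical complex; the hypotheses describe the possible types with $j<d-1$.) *)

(* Defs.v *)
From HB Require Import structures.
From mathcomp Require Import all_boot all_order all_algebra.

Set Implicit Arguments.
Unset Strict Implicit.
Unset Printing Implicit Defensive.

Import GRing.Theory Num.Theory.
Local Open Scope ring_scope.

Definition catalan (n : nat) : rat := n.+1%:R^-1 * 'C((2 * n)%N, n)%:R.

(* The condition [s <= k] encodes the convention that a binomial coefficient
   with negative lower index is 0, which truncated subtraction would violate.
   No other subtraction below is truncated for k < d and s <= min(j, k). *)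
Definition toric_contrib (d i j : nat) : {poly rat} :=
  \sum_(k < d)
    catalan (d - 1 - k) *: ((1 - 'X) ^+ k * 'X^(d - k)) *
    (\sum_(s < j.+1 | (s <= k)%N)
       ('C(j, s) * 'C(d + i + j - 1 - k - s, k - s))%N%:R)%:P.

(* Coefficient of 'X^e for an integer exponent; it is 0 when e is negative. *)
Definition coefz (p : {poly rat}) (e : int) : rat :=
  if e is Posz n then p`_n else 0.

Section NoncrossingPartitions.

Variable d : nat.

(* {1, ..., d-1} is the set of the nonzero elements of 'I_d = {0, ..., d-1},
   so that elements keep their own labels. *)
Definition ground : {set 'I_d} := [set v : 'I_d | (0 < v)%N].

Definition noncrossing (P : {set {set 'I_d}}) : bool :=
  [forall A in P, forall B in P,
   forall a in A, forall b in B, forall c in A, forall e in B,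
     [&& a < b, b < c & c < e]%N ==> (A == B)].

Definition is_min (v : 'I_d) (B : {set 'I_d}) : bool :=
  (v \in B) && [forall w in B, (v <= w)%N].

Definition is_max (v : 'I_d) (B : {set 'I_d}) : bool :=
  (v \in B) && [forall w in B, (w <= v)%N].

Definition contains_one (B : {set 'I_d}) : bool :=
  [exists u in B, val u == 1%N].

Definition special (i j : nat) (P : {set {set 'I_d}}) (v : 'I_d) : bool :=
  [exists B in P, (v \in B) &&
    [|| is_min v B && (2 <= #|B|)%N,
        (B == [set v]) && ((v <= i)%N || (d - j <= v)%N)
      | [&& (d - j <= v)%N, ~~ is_min v B & is_max v B ==> contains_one B]]].

Definition nc_with (i j : nat) (m : int) : {set {set {set 'I_d}}} :=
  [set P : {set {set 'I_d}} |
    [&& partition P ground, noncrossing P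
      & #|[set v : 'I_d | special i j P v]|%:Z == m]].

End NoncrossingPartitions.

(* Main.v *)
Require Import Defs.
From mathcomp Require Import all_boot all_order all_algebra.
From mathcomp Require Import zify ring.

Set Implicit Arguments.
Unset Strict Implicit.
Unset Printing Implicit Defensive.

Import GRing.Theory Num.Theory.

(* Give special elements weight 1 and the others weight x; with n = d - 1, let
   F(n, i, j) be the total weight of the noncrossing partitions of {1, ..., n}.
   The only difference between j + 1 and j is the status of one element v, and
   removing v when it is a newly special singleton, respectively a newly
   special element joined to its block, gives in both cases F(n - 1, i, j);
   hence F(n, i, j + 1) = F(n, i, j) + 2 (1 - x) F(n - 1, i, j). Likewise
   F(n, i + 1, 0) = F(n, i, 0) + (1 - x) F(n - 1, i, 0). By Pascal's rule the
   closed form satisfies the same recurrences. For i = j = 0 the generating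
   function T(t) satisfies T = 1 + (x t + x (1 - x) t^2) T^2, so it is the
   Catalan series evaluated at x t + x (1 - x) t^2.

   The recurrences are proved on words: a noncrossing partition is determined
   by which elements are minima and which are maxima of their blocks, and the
   admissible words are those of a stack of open blocks that ends empty. *)

Local Open Scope ring_scope.

(* An element of a partition is recorded as the pair (minimum of its block,
   maximum of its block); [step_height] updates the number of open blocks. *)
Notation letter := (bool * bool)%type.

(* A position is recorded as the pair (its singleton is special, v >= d - j);
   [zone1], [zone2], [zone3] are v <= i, i < v < d - j and v >= d - j. *)
Notation zone := (bool * bool)%type.
Notation zone1 := (true, false).
Notation zone2 := (false, false).
Notation zone3 := (true, true).

Definition step_height (h : nat) (l : letter) : nat := (h + l.1 - l.2)%N.

(* [h] blocks are open before the letter, and [f] tells whether the block of 1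
   is one of them, so that [f && (h == 1)] says that it is the innermost one. By
   convention [f] is also true before the first letter, where [h] is 0. *)
Definition is_special (r : zone) (h : nat) (f : bool) (l : letter) : bool :=
  if l.1 then (if l.2 then r.1 else true)
  else r.2 && (l.2 ==> f && (h == 1%N)).

(** * Weighted sums over words *)

Section Transfer.
Variables (R : comNzRingType) (x : R).

Definition weight (special : bool) : R := if special then 1 else x.

(** Transfer-matrix form of the total weight: inductions run over the list of zones, and
    [wsum_words] recovers the sum over words. *)
Fixpoint wsum (rs : seq zone) (h : nat) (f : bool) : R :=
  if rs is r :: rs' then
    \sum_(l : letter | l.1 || (0 < h)%N)
      weight (is_special r h f l) *
        wsum rs' (step_height h l) (f && (0 < step_height h l)%N)
  else (h == 0%N)%:R.

Lemma big_letter (P : pred letter) (F : letter -> R) :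
  \sum_(l : letter | P l) F l =
  (if P (true, true) then F (true, true) else 0) +
  (if P (true, false) then F (true, false) else 0) +
  ((if P (false, true) then F (false, true) else 0) +
  (if P (false, false) then F (false, false) else 0)).
Proof.
transitivity (\sum_a \sum_b if P (a, b) then F (a, b) else 0).
  by rewrite big_mkcond pair_bigA; apply: eq_bigr => -[].
by rewrite big_bool !big_bool.
Qed.

Lemma wsum_cons0 r rs f :
  wsum (r :: rs) 0 f = wsum rs 1 f + weight r.1 * wsum rs 0 false.
Proof.
rewrite /= big_letter /= /step_height /is_special /= !addr0 !andbT !andbF.
by rewrite /weight mul1r addrC.
Qed.

Lemma wsum_consS r rs h f : wsum (r :: rs) h.+1 f =
  wsum rs h.+2 f + (weight r.1 + weight r.2) * wsum rs h.+1 f +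
  weight (r.2 && (f && (h == 0%N))) * wsum rs h (f && (0 < h)%N).
Proof.
rewrite /= big_letter /= /step_height /is_special /=.
rewrite !addn0 !addn1 !subn0 !subn1 /= !andbT eqSS.
ring.
Qed.

(** The two zones differ only in the weight of the singleton letter, whose deletion keeps the
    height. With the flag false, a singleton at height 0 has no flag to clear. *)
Lemma wsum_zone12 p rs h :
  wsum (p ++ zone1 :: rs) h false =
  wsum (p ++ zone2 :: rs) h false + (1 - x) * wsum (p ++ rs) h false.
Proof.
elim: p h => [|r p IH] [|h]; rewrite ?cat_cons ?cat0s ?wsum_cons0 ?wsum_consS ?IH /=.
- ring.
- ring.
- ring.
- ring.
Qed.

(* [wsum_join rs p h f] sums over the words for [p ++ zone3 :: rs] whose letter in
   the displayed zone is a non-minimal special one, that letter being given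
   weight 1. *)
Fixpoint wsum_join (rs p : seq zone) (h : nat) (f : bool) : R :=
  if p is r :: p' then
    \sum_(l : letter | l.1 || (0 < h)%N)
      weight (is_special r h f l) *
        wsum_join rs p' (step_height h l) (f && (0 < step_height h l)%N)
  else (0 < h)%N%:R * wsum rs h f + (f && (h == 1%N))%:R * wsum rs 0 false.

Lemma wsum_join_cons0 rs r p f :
  wsum_join rs (r :: p) 0 f = wsum_join rs p 1 f + weight r.1 * wsum_join rs p 0 false.
Proof.
rewrite /= big_letter /= /step_height /is_special /= !addr0 !andbT !andbF.
by rewrite /weight mul1r addrC.
Qed.

Lemma wsum_join_consS rs r p h f : wsum_join rs (r :: p) h.+1 f =
  wsum_join rs p h.+2 f + (weight r.1 + weight r.2) * wsum_join rs p h.+1 f +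
  weight (r.2 && (f && (h == 0%N))) * wsum_join rs p h (f && (0 < h)%N).
Proof.
rewrite /= big_letter /= /step_height /is_special /=.
rewrite !addn0 !addn1 !subn0 !subn1 /= !andbT eqSS.
ring.
Qed.

(** Two more kinds of letter become special: singletons, whose deletion leaves a word for [p ++ rs],
    and the non-minimal letters collected by [wsum_join]. The condition on [f] excludes a true flag
    on an empty stack, which a singleton would clear. *)
Lemma wsum_zone23 p rs h (f : bool) : (f -> (0 < h)%N) -> wsum (p ++ zone3 :: rs) h f =
  wsum (p ++ zone2 :: rs) h f + (1 - x) * (wsum (p ++ rs) h f + wsum_join rs p h f).
Proof.
elim: p h f => [|r p IH] [|h] f hf.
- rewrite !cat0s !wsum_cons0 /=; case: f hf => [/(_ isT)//|_] /=; ring.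
- rewrite !cat0s !wsum_consS /= eqSS.
  by case: f {hf}; case: h => [|h] /=; rewrite ?eqxx /=; ring.
- rewrite !cat_cons !wsum_cons0 wsum_join_cons0 !IH //; ring.
- rewrite !cat_cons !wsum_consS wsum_join_consS !IH; first ring.
  all: by move=> // /andP[].
Qed.

(* Deleting a joined letter from the block below it is a bijection: its inverse
   adds the new element to the innermost block spanning the gap or, if there is
   none, to the block of 1. *)
Lemma wsum_join_shift rs p h : all (fun r : zone => ~~ r.2) p ->
  wsum (p ++ rs) h.+1 true + wsum (p ++ rs) h false =
  wsum_join rs p h.+1 true + wsum_join rs p h false.
Proof.
elim: p h => [|r p IH] h.
  by case: h => [|h] _ /=; rewrite ?eqxx; ring.
rewrite [all _ _]/= => /andP[/negPf r2 allp]; rewrite cat_cons.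
have {}IH k := IH k allp.
case: h => [|h].
  rewrite !wsum_consS !wsum_cons0 !wsum_join_consS !wsum_join_cons0 r2 /=.
  have e0 := IH 0%N; have e1 := IH 1%N.
  transitivity ((wsum (p ++ rs) 2 true + wsum (p ++ rs) 1 false) +
    (weight r.1 + x) * (wsum (p ++ rs) 1 true + wsum (p ++ rs) 0 false)).
    ring.
  rewrite e0 e1; ring.
rewrite !wsum_consS !wsum_join_consS r2 /=.
have e0 := IH h; have e1 := IH h.+1; have e2 := IH h.+2.
transitivity ((wsum (p ++ rs) h.+3 true + wsum (p ++ rs) h.+2 false) +
    (weight r.1 + x) * (wsum (p ++ rs) h.+2 true + wsum (p ++ rs) h.+1 false)
    + x * (wsum (p ++ rs) h.+1 true + wsum (p ++ rs) h false)).
  ring.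
rewrite e0 e1 e2; ring.
Qed.

(** The first letter has weight 1 whether it opens the block of 1 or is a singleton, so the sum
    splits into the two states that [wsum_join_shift] combines. Singletons and joined letters then
    contribute equally, whence the factor 2. *)
Lemma wsum_zone23_join p rs : all (fun r : zone => ~~ r.2) p ->
  wsum (zone1 :: p ++ zone3 :: rs) 0 true =
  wsum (zone1 :: p ++ zone2 :: rs) 0 true + 2 * (1 - x) * wsum (zone1 :: p ++ rs) 0 true.
Proof.
move=> /(@wsum_join_shift rs _ 0%N) e.
rewrite !wsum_cons0 !wsum_zone23 //=.
transitivity (wsum (p ++ zone2 :: rs) 1 true + wsum (p ++ zone2 :: rs) 0 false +
  (1 - x) * (wsum (p ++ rs) 1 true + wsum (p ++ rs) 0 false
   + (wsum_join rs p 1 true + wsum_join rs p 0 false))).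
  ring.
rewrite -e; ring.
Qed.

Lemma wsum_flag rs h f : all (fun r : zone => ~~ r.2) rs -> wsum rs h f = wsum rs h false.
Proof.
elim: rs h f => [//|r rs IH] h f; rewrite [all _ _]/= => /andP[/negPf r2 allr].
case: h => [|h]; rewrite ?wsum_cons0 ?wsum_consS ?r2 /= ?(IH _ f) //.
by rewrite (IH h (_ && _)).
Qed.

(** * Words over [zone2] and their quadratic recurrence *)

Definition zone2_sum n h := wsum (nseq n zone2) h false.
Notation T n := (zone2_sum n 0).

Lemma zone2_sum0S n : T n.+1 = zone2_sum n 1 + x * T n.
Proof. by rewrite /zone2_sum (wsum_cons0 zone2 (nseq n zone2)). Qed.

Lemma zone2_sumS n h : zone2_sum n.+1 h.+1 =
  zone2_sum n h.+2 + 2 * x * zone2_sum n h.+1 + x * zone2_sum n h.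
Proof. rewrite /zone2_sum (wsum_consS zone2 (nseq n zone2)) /=; ring. Qed.

(** Decomposition at the first letter of the innermost initially open block: the [n - a] letters
    before it form a complete word above that block, and the letter itself, of weight x, closes the
    block or leaves it open for the last [a] letters. *)
Lemma zone2_sum_height n h : zone2_sum n.+1 h.+1 =
  x * \sum_(a < n.+1) T (n - a) * (zone2_sum a h + zone2_sum a h.+1).
Proof.
elim: n h => [|n IH] h.
  rewrite big_ord1 zone2_sumS /zone2_sum /=; case: h => [|h] /=; ring.
rewrite zone2_sumS !IH [in RHS]big_ord_recl subn0.
under [X in _ = x * (_ + X)]eq_bigr do rewrite !lift0 subSS.
case: h => [|h].
  under [X in _ = x * (_ + X)]eq_bigr do rewrite zone2_sum0S zone2_sumS.
  rewrite [T 0]/zone2_sum [zone2_sum 0 1]/zone2_sum /= addr0 mulr1 [in RHS]mulrDr addrC.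
  congr (_ + _).
  rewrite !mulr_sumr -!big_split /=; apply: eq_bigr => a _.
  ring.
under [X in _ = x * (_ + X)]eq_bigr do rewrite !zone2_sumS.
rewrite IH [zone2_sum 0 h.+1]/zone2_sum [zone2_sum 0 h.+2]/zone2_sum /= addr0 mulr0 add0r.
rewrite !mulr_sumr -!big_split /=; apply: eq_bigr => a _.
ring.
Qed.

Lemma zone2_sum1 : T 1 = x. Proof. by rewrite zone2_sum0S /zone2_sum /= add0r mulr1. Qed.

(* With u = t + (1 - x) t^2, this says that the generating function of [T]
   satisfies T = 1 + x u T^2, as the Catalan series evaluated at x u does. *)
Lemma zone2_sum_conv n : T n.+2 = x * \sum_(a < n.+2) T (n.+1 - a) * T a +
  x * (1 - x) * \sum_(a < n.+1) T (n - a) * T a.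
Proof.
(* Eliminating height 1 through [zone2_sum0S] produces the factor 1 - x of the second
   convolution. *)
have E : \sum_(a < n.+1) T (n - a) * zone2_sum a 1 =
    \sum_(a < n.+1) T (n - a) * T a.+1 - x * \sum_(a < n.+1) T (n - a) * T a.
  rewrite mulr_sumr -sumrB; apply: eq_bigr => a _; rewrite zone2_sum0S; ring.
rewrite zone2_sum0S zone2_sum_height.
under eq_bigr do rewrite mulrDr.
rewrite big_split /= E [in X in _ = X + _]big_ord_recl subn0.
under [X in _ = x * (_ + X) + _]eq_bigr do rewrite !lift0 subSS.
rewrite [T 0 in RHS]/zone2_sum /=.
ring.
Qed.

End Transfer.

(** * The closed form *)

Lemma catalan0 : catalan 0 = 1.
Proof. by rewrite /catalan bin0 divr1. Qed.

Lemma catalanS n : n.+2%:R * catalan n.+1 = (4 * n + 2)%:R * catalan n.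
Proof.
have nz k : k.+1%:R != 0 :> rat by rewrite pnatr_eq0.
have E : (n.+1 * 'C(2 * n.+1, n.+1) = 2 * (2 * n).+1 * 'C(2 * n, n))%N.
  have := mul_bin_diag (2 * n).+2 n; have := mul_bin_down (2 * n).+1 n.
  by rewrite (_ : 2 * n.+1 = (2 * n).+2)%N /=; lia.
rewrite /catalan mulrA mulfV // mul1r.
apply: (mulfI (nz n)); rewrite -natrM E.
have -> : (4 * n + 2 = 2 * (2 * n).+1)%N by lia.
by rewrite natrM mulrCA mulVKf.
Qed.

(** Segner's recurrence follows from the ratio recurrence [catalanS]: the sum [W], weighted by
    [a.+1], is evaluated once by reversing the index and once by [catalanS] with the induction
    hypothesis. *)
Lemma catalan_conv n : \sum_(a < n.+1) catalan a * catalan (n - a) = catalan n.+1.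
Proof.
elim: n => [|n IH].
  have := catalanS 0; rewrite big_ord1 catalan0 => e.
  by apply: (mulfI (_ : 2%:R != 0 :> rat)); rewrite // e.
set S := (X in X = _).
have nz k : k.+1%:R != 0 :> rat by rewrite pnatr_eq0.
pose W := \sum_(a < n.+2) a.+1%:R * (catalan a * catalan (n.+1 - a)).
have W1 : 2 * W = (n + 3)%:R * S.
  have -> : 2 * W = W + W by ring.
  rewrite {2}/W (reindex_inj rev_ord_inj) /= /W -big_split mulr_sumr.
  apply: eq_bigr => a _; rewrite /= subSS.
  have le_a : (a <= n.+1)%N by rewrite -ltnS.
  rewrite subKn //.
  have -> : (n + 3)%:R = a.+1%:R + (n.+1 - a).+1%:R :> rat.
    by rewrite -natrD; congr _%:R; lia.
  ring.
have W2 : W = (2 * n + 3)%:R * catalan n.+1.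
  rewrite /W big_ord_recl subn0 catalan0 !mul1r.
  transitivity (catalan n.+1 +
      \sum_(a < n.+1) (4 * a + 2)%:R * (catalan a * catalan (n - a))).
    congr (_ + _); apply: eq_bigr => a _.
    by rewrite !lift0 subSS mulrA catalanS mulrA.
  set V := \sum_(a < _) (4 * a + 2)%:R * _.
  have V2 : 2 * V = (4 * n + 4)%:R * \sum_(a < n.+1) catalan a * catalan (n - a).
    have -> : 2 * V = V + V by ring.
    rewrite {2}/V (reindex_inj rev_ord_inj) /= /V -big_split mulr_sumr.
    apply: eq_bigr => a _; rewrite /= subSS.
    have le_a : (a <= n)%N by rewrite -ltnS.
    rewrite subKn //.
    have -> : (4 * n + 4)%:R = (4 * a + 2)%:R + (4 * (n - a) + 2)%:R :> rat.
      by rewrite -natrD; congr _%:R; lia.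
    ring.
  apply: (mulfI (_ : 2%:R != 0 :> rat)); first by [].
  rewrite mulrDr V2 IH; move: (catalan n.+1) => c.
  rewrite mulrA -mulrDl -natrM -natrD; congr (_%:R * _); lia.
apply: (mulfI (nz (n + 2)%N)).
have -> : ((n + 2).+1 = n.+3)%N by lia.
rewrite (_ : n.+3 = n + 3)%N; last by lia.
rewrite -W1 W2 (_ : (n + 3)%N = n.+3); last by lia.
by rewrite catalanS mulrA -natrM; congr (_%:R * _); lia.
Qed.

Section ClosedForm.
Notation R := {poly rat}.
Notation x := ('X : R).

Definition binsum (N j k : nat) : nat :=
  \sum_(s < j.+1 | (s <= k)%N) 'C(j, s) * 'C(N + j - k - s, k - s).

Definition closed_form (n i j : nat) : R :=
  \sum_(k < n.+1) catalan (n - k) *: ((1 - x) ^+ k * x ^+ (n - k)) *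
    (binsum (n + i) j k)%:R.

Lemma toric_contrib_closed_form n i j :
  toric_contrib n.+1 i j = x * closed_form n i j.
Proof.
rewrite /toric_contrib /closed_form mulr_sumr; apply: eq_bigr => k _.
rewrite subn1 /= subSn; last by rewrite -ltnS.
rewrite exprS -!scalerAl -scalerAr; congr (_ *: _).
rewrite /binsum -polyC_natr natr_sum -!mulrA mulrCA; congr (_ * (_ * (_ * polyC _))).
by apply: eq_bigr => s _; congr ((_ * 'C(_, _))%:R)%N; lia.
Qed.

Lemma binsum0 N k : binsum N 0 k = 'C(N - k, k).
Proof. by rewrite /binsum big_mkcond big_ord1 leq0n mul1n addn0 !subn0. Qed.

Lemma binsumn0 N j : binsum N j 0 = 1%N.
Proof.
rewrite /binsum (bigD1 ord0) //= big1 ?bin0 // => s /andP[].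
by rewrite leqn0 => /eqP s0 /negP; case; apply/eqP/val_inj.
Qed.

Lemma binsum0S N k : (k < N)%N ->
  binsum N.+1 0 k.+1 = (binsum N 0 k.+1 + binsum N.-1 0 k)%N.
Proof.
by case: N => // N kN; rewrite !binsum0 /= !subSS subSn.
Qed.

(** Pascal's rule on ['C(j.+1, s)] gives each s the terms [G s] and [G s.+1]; Pascal's rule on [G s]
    then yields a second copy of [G s.+1], whence the factor 2. *)
Lemma binsumS N j k : (k < N)%N ->
  binsum N j.+1 k.+1 = (binsum N j k.+1 + 2 * binsum N.-1 j k)%N.
Proof.
move=> kN; rewrite /binsum.
pose G (s : nat) := ('C(N + j.+1 - k.+1 - s, k.+1 - s))%N.
pose c (s : nat) := (if (s <= k.+1)%N then G s else 0)%N.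
have lhsE : (\sum_(s < j.+2 | (s <= k.+1)%N) 'C(j.+1, s) * G s =
  \sum_(s < j.+2) 'C(j.+1, s) * c s)%N.
  by rewrite big_mkcond; apply: eq_bigr => s _; rewrite /c; case: ifP; rewrite ?muln0.
rewrite lhsE.
have -> : (\sum_(s < j.+2) 'C(j.+1, s) * c s =
  \sum_(s < j.+1) 'C(j, s) * c s + \sum_(s < j.+1) 'C(j, s) * c s.+1)%N.
  rewrite big_ord_recl bin0.
  under eq_bigr do rewrite lift0 binS mulnDl.
  rewrite big_split /= addnA; congr (_ + _)%N.
  rewrite big_ord_recr /= bin_small // addn0.
  by rewrite [in RHS]big_ord_recl bin0.
rewrite [X in (_ = X + _)%N]big_mkcond [X in (_ = _ + 2 * X)%N]big_mkcond.
rewrite big_distrr /= -!big_split /=; apply: eq_bigr => s _.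
have ls : (s <= j)%N by rewrite -ltnS.
rewrite /c /G ltnS.
have -> : (N + j.+1 - k.+1 - s.+1 = N.-1 + j - k - s)%N by lia.
case: (ltngtP s k.+1) => sk.
- have sk' : (s <= k)%N by rewrite -ltnS.
  rewrite ltnS in sk; rewrite ?(leqW sk') ?sk' subSn // subSS.
  have -> : (N + j.+1 - k.+1 - s = (N.-1 + j - k - s).+1)%N by lia.
  have -> : (N + j - k.+1 - s = N.-1 + j - k - s)%N by lia.
  rewrite binS; lia.
- have -> : (s <= k)%N = false by lia.
  by rewrite muln0.
- by rewrite sk ltnn subnn !bin0 muln0.
Qed.

(** The terms with k = 0 agree; in the others, the shift from k to k + 1 releases one factor 1 - x,
    while the Catalan index and the power of x stay n - k. *)
Lemma closed_form_rec n i j i' j' c :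
  (forall k, (k < n.+1 + i)%N -> binsum (n.+1 + i') j' k.+1 =
    (binsum (n.+1 + i) j k.+1 + c * binsum (n + i) j k)%N) ->
  closed_form n.+1 i' j' = closed_form n.+1 i j + c%:R * (1 - x) * closed_form n i j.
Proof.
move=> H; rewrite /closed_form big_ord_recl [in RHS]big_ord_recl !binsumn0 -addrA.
congr (_ + _); rewrite mulr_sumr -big_split; apply: eq_bigr => k _.
rewrite lift0 subSS H; last by have := ltn_ord k; lia.
rewrite natrD natrM exprS -!mul_polyC /=; ring.
Qed.

Lemma closed_formS0 n i :
  closed_form n.+1 i.+1 0 = closed_form n.+1 i 0 + (1 - x) * closed_form n i 0.
Proof.
rewrite (@closed_form_rec n i 0 _ _ 1) ?mul1r // => k kn.
by rewrite addnS binsum0S // mul1n addSn.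
Qed.

Lemma closed_formS n i j : closed_form n.+1 i j.+1 =
  closed_form n.+1 i j + 2 * (1 - x) * closed_form n i j.
Proof.
by apply: (@closed_form_rec n i j _ _ 2) => k kn; rewrite binsumS // addSn.
Qed.

(** * The Catalan series evaluated at x t + x (1 - x) t^2 *)

Notation T n := (zone2_sum x n 0).

(** The outer variable ['X] is t; once t^m is taken out, the binomial theorem applies to (1 + (1 -
    x) t)^m. *)
Lemma coef_exp_XDX2 m k :
  (('X + (1 - x)%:P * 'X^2) ^+ m)`_(m + k) = (1 - x) ^+ k *+ 'C(m, k).
Proof.
have -> : 'X + (1 - x)%:P * 'X^2 = 'X * (1 + (1 - x)%:P * 'X) :> {poly R} by ring.
rewrite exprMn coefXnM ltnNge leq_addr /= addKn exprDn coef_sum.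
have E (i : 'I_m.+1) : (1 ^+ (m - i) * ((1 - x)%:P * 'X) ^+ i *+ 'C(m, i) : {poly R})`_k
    = (1 - x) ^+ i * (k == i)%:R *+ 'C(m, i).
  by rewrite expr1n mul1r exprMn -rmorphXn coefMn coefCM coefXn.
rewrite (eq_bigr _ (fun i _ => E i)).
case: (ltnP k m.+1) => km.
  rewrite (bigD1 (Ordinal km)) //= eqxx mulr1 big1 ?addr0 // => i.
  by rewrite -val_eqE eq_sym /= => /negPf ->; rewrite mulr0 mul0rn.
rewrite bin_small // big1 // => i _.
by rewrite (_ : k == i = false) ?mulr0 ?mul0rn //; have := ltn_ord i; lia.
Qed.

Definition catalan_arg : {poly R} := x%:P * ('X + (1 - x)%:P * 'X^2).

Definition catalan_poly N : {poly R} := \poly_(m < N) (catalan m)%:P.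

(** The truncated Catalan series satisfies C = 1 + t C^2 modulo t^N. The cofactor [D] is exhibited
    so that the error can be followed through composition. *)
Lemma catalan_poly_conv N :
  {D | catalan_poly N = 1 + 'X * catalan_poly N ^+ 2 + 'X^N * D}.
Proof.
set E := catalan_poly N - (1 + 'X * catalan_poly N ^+ 2).
exists (drop_poly N E).
have E0 : take_poly N E = 0.
  apply/polyP => m; rewrite coef_take_poly coef0; case: ifP => // mN.
  rewrite coefB coefD coefXM coef1 /catalan_poly coef_poly mN.
  case: m mN => [|m] mN /=; first by rewrite catalan0 addr0 subrr.
  rewrite add0r expr2 coefM -catalan_conv rmorph_sum -sumrB big1 // => a _.
  have am : (a <= m)%N by rewrite -ltnS.
  have aN : (a < N)%N by lia.
  have bN : (m - a < N)%N by lia.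
  by rewrite !coef_poly aN bN rmorphM subrr.
have := poly_take_drop N E; rewrite E0 add0r mulrC => ->.
by rewrite /E addrC subrK.
Qed.

Definition catalan_gf N : {poly R} := catalan_poly N \Po catalan_arg.

(** Composition turns the error into a multiple of [catalan_arg ^+ N], which t^N divides because
    [catalan_arg] has no constant term. *)
Lemma catalan_gf_conv N n : (n < N)%N ->
  (catalan_gf N)`_n = (n == 0%N)%:R + (catalan_arg * catalan_gf N ^+ 2)`_n.
Proof.
move=> nN; have [D eD] := catalan_poly_conv N.
rewrite {1}/catalan_gf eD !comp_polyD !comp_polyM !rmorphXn /= comp_polyX comp_polyC.
rewrite -/(catalan_gf N) !coefD coef1.
have -> : catalan_arg = 'X * (x%:P * (1 + (1 - x)%:P * 'X)) by rewrite /catalan_arg; ring.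
by rewrite exprMn -!mulrA coefXnM nN addr0.
Qed.

(** As [catalan_arg] has no constant term, the quadratic equation expresses each coefficient by
    earlier ones, and from n = 2 on this is the recursion [zone2_sum_conv]. *)
Lemma coef_catalan_gf N n : (n < N)%N -> T n = (catalan_gf N)`_n.
Proof.
elim/ltn_ind: n => -[|[|n]] IH nN; rewrite catalan_gf_conv //= /catalan_arg;
  rewrite -mulrA coefCM mulrDl coefD.
- by rewrite /zone2_sum coefXM -mulrA coefCM coefXnM /= mulr0 addr0 mulr0 addr0.
- rewrite zone2_sum1 add0r coefXM -mulrA coefCM coefXnM /= mulr0 addr0.
  rewrite expr2 coefM big_ord1.
  by rewrite -(IH 0%N) //; last exact: ltnW; rewrite [zone2_sum x 0 0](_ : _ = 1) ?mulr1.
rewrite add0r coefXM -mulrA coefCM coefXnM /= subSS subn1 /= expr2 !coefM.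
rewrite zone2_sum_conv [in RHS]mulrDr [in RHS]mulrA.
congr (_ * _ + _ * _); apply: eq_bigr => a _; have := ltn_ord a => la.
  by rewrite mulrC !IH //; lia.
by rewrite mulrC !IH //; lia.
Qed.

Lemma zone2_sum_closed_form n : T n = closed_form n 0 0.
Proof.
rewrite (@coef_catalan_gf n.+1) // /catalan_gf /catalan_poly poly_def raddf_sum coef_sum.
rewrite (reindex_inj rev_ord_inj); apply: eq_bigr => k _ /=.
rewrite subSS comp_polyZ rmorphXn /= comp_polyX coefZ exprMn -rmorphXn coefCM.
have kn : (k <= n)%N by rewrite -ltnS.
have := coef_exp_XDX2 (n - k) k; rewrite subnK // => ->.
rewrite binsum0 addn0 -mul_polyC -mulr_natr.
ring.
Qed.

(** * Evaluation of the weighted sums *)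

Definition zones n i j : seq zone :=
  nseq i zone1 ++ nseq (n - i - j) zone2 ++ nseq j zone3.

Lemma wsum_zones0 n i : (i <= n)%N -> wsum x (zones n i 0) 0 false = closed_form n i 0.
Proof.
elim: i n => [|i IH] n; first by rewrite /zones !subn0 cats0 -zone2_sum_closed_form.
case: n => // n lin; rewrite closed_formS0 -!IH //; last exact: ltnW.
(* The last [zone1] is split off, to be traded for a [zone2]. *)
rewrite /zones !cats0 !subn0 subSS subSn // -[in LHS]addn1 nseqD -catA.
exact: wsum_zone12.
Qed.

(** The induction on j trades the first [zone3] for a [zone2]; i > 0 supplies the leading [zone1]
    required by [wsum_zone23_join]. *)
Lemma wsum_zones n i j : (0 < i)%N || (j == 0%N) -> (i + j <= n)%N ->
  wsum x (zones n i j) 0 true = closed_form n i j.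
Proof.
elim: j n => [|j IH] n.
  rewrite addn0 => _ lin; rewrite wsum_flag ?wsum_zones0 //.
  by rewrite !all_cat !all_nseq /= !orbT.
case: i IH => // i IH _; case: n => [|n] lijn; first by lia.
rewrite closed_formS -!IH //; [|lia|lia].
rewrite /zones.
have -> : (n.+1 - i.+1 - j.+1 = n - i.+1 - j)%N by lia.
have -> : (n.+1 - i.+1 - j = (n - i.+1 - j).+1)%N by lia.
have allp m : all (fun r : zone => ~~ r.2) (nseq i zone1 ++ nseq m zone2).
  by rewrite all_cat !all_nseq /= !orbT.
have := wsum_zone23_join x (nseq j zone3) (allp (n - i.+1 - j)%N).
rewrite -!catA /= => ->; congr (wsum _ (_ :: _ ++ _) _ _ + _).
by elim: (n - i.+1 - j)%N => //= m ->.
Qed.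

End ClosedForm.

Local Open Scope nat_scope.

(** * Encoding noncrossing partitions by words *)

Fixpoint valid (h : nat) (w : seq letter) : bool :=
  if w is l :: w' then (l.1 || (0 < h)) && valid (step_height h l) w' else h == 0.

Fixpoint height (h : nat) (w : seq letter) (k : nat) : nat :=
  match k, w with k'.+1, l :: w' => height (step_height h l) w' k' | _, _ => h end.

Fixpoint flag (h : nat) (f : bool) (w : seq letter) (k : nat) : bool :=
  match k, w with
  | k'.+1, l :: w' => flag (step_height h l) (f && (0 < step_height h l)) w' k'
  | _, _ => f
  end.

Fixpoint nonspecial (rs : seq zone) (h : nat) (f : bool) (w : seq letter) : nat :=
  match rs, w with
  | r :: rs', l :: w' =>
      ~~ is_special r h f l +
        nonspecial rs' (step_height h l) (f && (0 < step_height h l)) w'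
  | _, _ => 0
  end.

Notation letter0 := (false, false).

Lemma height0 h w : height h w 0 = h. Proof. by case: w. Qed.

Lemma heightS h w k : k < size w ->
  height h w k.+1 = step_height (height h w k) (nth letter0 w k).
Proof. by elim: w h k => // l w IH h [|k] /=; [rewrite height0 | exact: IH]. Qed.

Lemma valid_step h w k : valid h w -> k < size w ->
  (nth letter0 w k).1 || (0 < height h w k).
Proof. by elim: w h k => //= l w IH h [|k] /= /andP[//]; move=> _; exact: IH. Qed.

Lemma valid_end h w : valid h w -> height h w (size w) = 0.
Proof. by elim: w h => [|l w IH] h /=; [move/eqP | case/andP => _ /IH]. Qed.

Lemma valid_height h w k : valid h w -> k < size w ->
  height h w k.+1 + (nth letter0 w k).2 = height h w k + (nth letter0 w k).1.
Proof.
move=> vw kw; have := valid_step vw kw; rewrite heightS // /step_height.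
by case: (nth letter0 w k) => -[] []; case: (height h w k) => //= *; lia.
Qed.

(** Meant for [H] counting the open blocks of a partition; the additive step relation avoids
    truncated subtraction. *)
Lemma validP (H : nat -> nat) w :
  (forall k, k < size w -> (nth letter0 w k).1 || (0 < H k)) ->
  (forall k, k < size w -> H k.+1 + (nth letter0 w k).2 = H k + (nth letter0 w k).1) ->
  H (size w) = 0 -> valid (H 0) w.
Proof.
elim: w H => [|l w IH] H /= H1 H2 H3; first exact/eqP.
rewrite (H1 0) //=; have <- : H 1 = step_height (H 0) l.
  by have /= := H2 0 isT; rewrite /step_height; lia.
by apply: (IH (fun k => H k.+1)) => // k kw; [exact: (H1 k.+1)|exact: (H2 k.+1)].
Qed.

(** The index t = 0 is left out because the flag starts true on an empty stack. *)
Lemma flagP h (f : bool) w k : k <= size w ->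
  reflect (f /\ forall t, 0 < t <= k -> 0 < height h w t) (flag h f w k).
Proof.
move=> kw; apply: (iffP idP); elim: w h f k kw => [|l w IH] h f [|k] //= kw.
- by move=> ->; split=> // -[].
- by move=> ->; split=> // -[].
- move/IH => /(_ kw)[/andP[-> n0] Hk]; split=> // -[|[|t]] //= tk.
    by rewrite height0.
  exact: Hk.
- by case.
- by case.
- case=> f1 Hk; apply: IH => //; split; last by case=> // t; exact: (Hk t.+2).
  by rewrite f1 /=; have := Hk 1 isT; rewrite /= height0.
Qed.

Lemma nonspecialE rs h f w : size w = size rs ->
  nonspecial rs h f w = \sum_(k < size rs)
    ~~ is_special (nth zone2 rs k) (height h w k) (flag h f w k) (nth letter0 w k).
Proof.
elim: rs h f w => [|r rs IH] h f [|l w] //=; first by rewrite big_ord0.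
by move=> [sw]; rewrite big_ord_recl /= IH.
Qed.

Lemma big_tuple_cons (V : nmodType) (T : finType) n (P : pred (seq T)) (F : seq T -> V) :
  (\sum_(w : n.+1.-tuple T | P w) F w =
   \sum_(l : T) \sum_(w : n.-tuple T | P (l :: w)) F (l :: w))%R.
Proof.
rewrite pair_big_dep /=.
rewrite (reindex (fun p : T * n.-tuple T => [tuple of p.1 :: p.2])) /=.
  by apply: eq_bigl => p.
exists (fun w : n.+1.-tuple T => (thead w, behead_tuple w)).
  by case=> l w _; congr (_, _); apply: val_inj.
by move=> w _; rewrite [RHS]tuple_eta; apply: val_inj.
Qed.

Lemma wsum_words (R : comNzRingType) (x : R) rs h f :
  (\sum_(w : (size rs).-tuple letter | valid h w) x ^+ nonspecial rs h f w =
   wsum x rs h f)%R.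
Proof.
elim: rs h f => [|r rs IH] h f.
  rewrite big_mkcond (bigD1 [tuple]) //= big1 ?addr0; first by case: (h == 0).
  by move=> w; rewrite tuple0.
rewrite (@big_tuple_cons _ _ _ (valid h) (fun w => x ^+ nonspecial (r :: rs) h f w)%R) /=.
rewrite [RHS]big_mkcond; apply: eq_bigr => l _ /=.
case: ifP => l1; last by rewrite big_pred0.
rewrite -IH mulr_sumr; apply: eq_bigr => w _.
by rewrite exprD; congr (_ * _)%R; rewrite /weight; case: is_special.
Qed.

(** * Blocks read off from a word *)

Section Decode.
Variable w : seq letter.
Local Notation H k := (height 0 w k).

(** Place in the stack of the block of position k, counting a block that k itself opens. *)
Definition level k := H k + (nth letter0 w k).1.

(* Positions u < v lie in the same block iff their blocks are at the same
   height of the stack of open blocks and this height persists between them. *)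
Definition joined (u v : nat) : Prop :=
  level u = level v /\
  forall t, (u < t <= v) || (v < t <= u) -> level u <= H t.

Lemma joined_refl u : joined u u.
Proof. by split=> // t; lia. Qed.

Lemma joined_sym u v : joined u v -> joined v u.
Proof. by case=> e Ht; split=> // t tuv; rewrite -e Ht // orbC. Qed.

Lemma joined_trans u v t : joined u v -> joined v t -> joined u t.
Proof.
case=> e1 H1 [e2 H2]; split=> [|s sut]; first by rewrite e1.
case: (boolP ((u < s <= v) || (v < s <= u))) => [/H1 //|suv].
by rewrite e1; apply: H2; lia.
Qed.

(** The chain level a <= H b <= level b <= H c <= level c = level a collapses to equalities. *)
Lemma joined_noncrossing a b c e :
  a < b -> b < c -> c < e -> joined a c -> joined b e -> joined a b.
Proof.
move=> ab bc ce [e1 H1] [e2 H2].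
have Hb : level a <= H b by apply: H1; lia.
have Hc : level b <= H c by apply: H2; lia.
have lb : H b <= level b by rewrite /level leq_addr.
have lc : H c <= level c by rewrite /level leq_addr.
split=> [|t tab]; first by lia.
by apply: H1; lia.
Qed.

Hypothesis vw : valid 0 w.

Lemma joined_before v : v < size w ->
  ~~ (nth letter0 w v).1 <-> exists2 u, u < v & joined u v.
Proof.
move=> vs; split=> [a0|[u uv [e Hu]]]; last first.
  apply/negP => a1; have : level u <= H v by apply: Hu; lia.
  by rewrite e /level a1; lia.
have Hv : 0 < H v by have := valid_step vw vs; rewrite (negPf a0).
(* The witness is the last earlier position with a lower stack: it opens the block of v. *)
pose Q u := (u < v) && (H u < H v).
have exQ : exists u, Q u.
  by exists 0; rewrite /Q height0 Hv andbT; case: (v) Hv; rewrite ?height0.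
have bQ u : Q u -> u <= v by case/andP => /ltnW.
case: (ex_maxnP exQ bQ) => u /andP[uv Huv] umax.
have above t : u < t <= v -> H v <= H t.
  case/andP => ut tv; rewrite leqNgt; apply/negP => Htv.
  move: tv; rewrite leq_eqVlt => /orP[/eqP tv|tv]; first by rewrite tv ltnn in Htv.
  by have := umax t; rewrite /Q Htv tv => /(_ isT); lia.
have us : u < size w by lia.
have := valid_height vw us; have := above u.+1 => Hu1 eu.
have lv : level v = H v by rewrite /level (negPf a0) addn0.
have lu : level u = H v.
  by rewrite /level; move: eu; case: (nth letter0 w u) => -[] [] /=; lia.
exists u => //; split=> [|t tuv]; first by rewrite lu lv.
by rewrite lu above //; lia.
Qed.

Lemma joined_after v : v < size w ->
  ~~ (nth letter0 w v).2 <-> exists2 u, v < u < size w & joined u v.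
Proof.
move=> vs; have eq_v := valid_height vw vs; split=> [b0|[u uv [e Hu]]]; last first.
  apply/negP => b1; have : level u <= H v.+1 by apply: Hu; lia.
  by rewrite e /level; lia.
have Hv1 : H v.+1 = level v by rewrite /level; move: eq_v; rewrite (negPf b0); lia.
have Lv : 0 < level v.
  by have := valid_step vw vs; rewrite /level; case: (nth letter0 w v).1; lia.
have He := valid_end vw.
have vs1 : v.+1 < size w.
  by rewrite ltn_neqAle vs andbT; apply/eqP => e; rewrite e He in Hv1; lia.
(* Dually, the witness closes the block of v: it is the first later position after which the stack
   is below the level of v. It exists because the stack ends empty. *)
pose Q u := (v < u < size w) && (H u.+1 < level v).
have exQ : exists u, Q u.
  exists (size w).-1; rewrite /Q prednK; last by lia.
  by rewrite He Lv; lia.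
case: (ex_minnP exQ) => u /andP[uv Hu1] umin.
have above t : v < t <= u -> level v <= H t.
  case/andP => vt tu; rewrite leqNgt; apply/negP => Htv.
  case: t vt tu Htv => // t vt tu Htv.
  move: vt; rewrite ltnS leq_eqVlt => /orP[/eqP vt|vt].
    by rewrite -vt Hv1 ltnn in Htv.
  have := umin t; rewrite /Q Htv andbT vt /=; lia.
have us : u < size w by lia.
have Hu := above u; have eu := valid_height vw us.
have lu : level u = level v.
  by rewrite {1}/level; move: eu; case: (nth letter0 w u) => -[] [] /=; lia.
exists u => //; split=> // t tuv; rewrite lu above //; lia.
Qed.

End Decode.

(** * Words of noncrossing partitions *)

Section Partitions.
Variable n : nat.
Notation T := 'I_n.+1.
Notation ground := (@ground n.+1).
Implicit Types (P : {set {set T}}) (u v : T).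

Notation same P u v := (v \in pblock P u).

Definition tmin P v := [forall u in pblock P v, v <= u].
Definition tmax P v := [forall u in pblock P v, u <= v].

Lemma same_refl P v : partition P ground -> 0 < v -> same P v v.
Proof. by move=> /cover_partition cP v0; rewrite mem_pblock cP inE. Qed.

Lemma same_block P B v : partition P ground -> B \in P -> v \in B -> pblock P v = B.
Proof. by case/and3P => _ tP _ BP vB; exact: def_pblock. Qed.

Lemma block_gt0 P B v : partition P ground -> B \in P -> v \in B -> 0 < v.
Proof.
move=> /cover_partition cP BP vB.
by have : v \in cover P; [apply/bigcupP; exists B | rewrite cP inE].
Qed.

Lemma pblockP P v : partition P ground -> 0 < v -> pblock P v \in P.
Proof. by move=> /cover_partition cP v0; rewrite pblock_mem // cP inE. Qed.

Lemma same_gt0 P u v : partition P ground -> 0 < u -> same P u v -> 0 < v.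
Proof. by move=> pP u0; apply: block_gt0 (pblockP pP u0). Qed.

Lemma same_eq P u v : partition P ground -> 0 < u -> same P u v ->
  pblock P v = pblock P u.
Proof. by move=> pP u0; apply: same_block => //; exact: pblockP. Qed.

Lemma same_sym P u v : partition P ground -> 0 < u -> same P u v -> same P v u.
Proof. by move=> pP u0 /(same_eq pP u0) ->; exact: same_refl. Qed.

Lemma same_trans P u v t : partition P ground -> 0 < u ->
  same P u v -> same P v t -> same P u t.
Proof. by move=> pP u0 /(same_eq pP u0) ->. Qed.

Lemma noncrossing_same P (a b c e : T) : partition P ground -> noncrossing P ->
  0 < a -> a < b -> b < c -> c < e -> same P a c -> same P b e -> same P a b.
Proof.
move=> pP ncP a0 ab bc ce ac be; have b0 : 0 < b by exact: ltn_trans ab.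
have Pa := pblockP pP a0; have Pb := pblockP pP b0.
move/forall_inP: ncP => /(_ _ Pa) /forall_inP /(_ _ Pb) /forall_inP.
move=> /(_ _ (same_refl pP a0)) /forall_inP /(_ _ (same_refl pP b0)).
move=> /forall_inP /(_ _ ac) /forall_inP /(_ _ be).
by rewrite ab bc ce => /eqP ->; exact: same_refl.
Qed.

Lemma noncrossing_intro P : partition P ground ->
  (forall a b c e : T, 0 < a -> a < b -> b < c -> c < e ->
     same P a c -> same P b e -> same P a b) -> noncrossing P.
Proof.
move=> pP H; apply/forall_inP => A PA; apply/forall_inP => B PB.
apply/forall_inP => a aA; apply/forall_inP => b bB.
apply/forall_inP => c cA; apply/forall_inP => e eB.
apply/implyP => /and3P[ab bc ce]; apply/eqP.
have a0 := block_gt0 pP PA aA; have b0 := block_gt0 pP PB bB.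
have Ea := same_block pP PA aA; have Eb := same_block pP PB bB.
have := H a b c e a0 ab bc ce; rewrite Ea Eb => /(_ cA eB) bA.
by rewrite -Eb (same_block pP PA bA).
Qed.

Lemma tminN P v : ~~ tmin P v = [exists u in pblock P v, u < v].
Proof. by rewrite negb_forall_in; apply: eq_existsb => u; rewrite ltnNge. Qed.

Lemma tmaxN P v : ~~ tmax P v = [exists u in pblock P v, v < u].
Proof. by rewrite negb_forall_in; apply: eq_existsb => u; rewrite ltnNge. Qed.

(** [lift ord0 k] is the element k + 1: positions start at 0, and the label 0, outside [ground],
    gets no letter. *)
Definition encode P : n.-tuple letter :=
  [tuple (tmin P (lift ord0 k), tmax P (lift ord0 k)) | k < n].

Lemma encodeE P (k : 'I_n) :
  nth letter0 (encode P) k = (tmin P (lift ord0 k), tmax P (lift ord0 k)).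
Proof. by rewrite -tnth_nth tnth_mktuple. Qed.

Definition open_blocks P k :=
  [set B in P | [exists u in B, u <= k] && [exists u in B, k < u]].

(** Only the block of v can change status: it is open before v unless v is its minimum, and open
    after v unless v is its maximum. *)
Lemma open_blocks_step P v k : partition P ground -> v = k.+1 :> nat ->
  #|open_blocks P k.+1| + tmax P v = #|open_blocks P k| + tmin P v.
Proof.
move=> pP vk; have v0 : 0 < v by rewrite vk.
have BP := pblockP pP v0; have vB := same_refl pP v0.
rewrite (cardsD1 (pblock P v) (open_blocks P k.+1)).
rewrite (cardsD1 (pblock P v) (open_blocks P k)).
have -> : (pblock P v \in open_blocks P k.+1) = ~~ tmax P v.
  rewrite inE BP /= tmaxN vk andb_idl // => _.
  by apply/exists_inP; exists v; rewrite // vk.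
have -> : (pblock P v \in open_blocks P k) = ~~ tmin P v.
  rewrite inE BP /= tminN andb_idr.
    by apply: eq_existsb => u; rewrite vk.
  by move=> _; apply/exists_inP; exists v; rewrite // vk.
have -> : open_blocks P k.+1 :\ pblock P v = open_blocks P k :\ pblock P v.
  apply/setP => B; rewrite !inE; case: eqP => //= /eqP neB.
  case BinP: (B \in P) => //=.
  have ne u : u \in B -> u != k.+1 :> nat.
    move=> uB; apply: contra neB => /eqP uk; apply/eqP.
    by rewrite -(same_block pP BinP uB); congr pblock; apply: val_inj; rewrite /= uk vk.
  congr (_ && _); apply: eq_existsb => u; case uB: (u \in B) => //=;
    by have := ne u uB; lia.
by rewrite addnAC [RHS]addnAC; congr addn; case: tmax; case: tmin.
Qed.

Lemma encode_valid P : partition P ground -> valid 0 (encode P).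
Proof.
move=> pP; have H0 : #|open_blocks P 0| = 0.
  apply/eqP; rewrite cards_eq0; apply/eqP/setP => B; rewrite !inE.
  apply/negP => /and3P[BP /exists_inP[u uB]].
  by have := block_gt0 pP BP uB; lia.
rewrite -H0; apply: (@validP (fun k => #|open_blocks P k|)); rewrite size_tuple.
- move=> k kn; rewrite (encodeE P (Ordinal kn)) /=; set v := lift _ _.
  have v0 : 0 < v by [].
  case m: (tmin P v) => //=; apply/card_gt0P; exists (pblock P v).
  rewrite inE pblockP //=; apply/andP; split; last first.
    by apply/exists_inP; exists v => //; rewrite same_refl.
  move/negbT: m; rewrite tminN => /exists_inP[u uB uv].
  by apply/exists_inP; exists u.
- by move=> k kn; rewrite (encodeE P (Ordinal kn)) /=; apply: open_blocks_step.
- apply/eqP; rewrite cards_eq0; apply/eqP/setP => B; rewrite !inE.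
  apply/negP => /and3P[BP _ /exists_inP[u uB]].
  by have := ltn_ord u; lia.
Qed.

Lemma tmin_pred P v : partition P ground -> 0 < v -> ~~ tmin P v ->
  exists2 p : T, 0 < p < v & same P p v /\ forall q : T, q < v -> same P q v -> q <= p.
Proof.
move=> pP v0; rewrite tminN => /exists_inP[u uv ltuv].
have Qu : (u < v) && same P v u by rewrite ltuv.
case: (@arg_maxnP _ u (fun u => (u < v) && same P v u) val Qu) => p /andP[pv vp] pmax.
exists p; first by rewrite pv andbT (same_gt0 pP v0 vp).
split=> [|q qv sq]; first exact: same_sym vp.
case: (posnP q) => [-> //|q0].
by apply: pmax; rewrite qv (same_sym pP q0 sq).
Qed.

(** If p < q, then q is not a maximum in [P'], hence not in [P], and its [P]-block has some x > q.
    If x < v, then x joins v in [P'], against the choice of q. If x > v, then p < q < v < x forces q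
    into the [P]-block of v, against the choice of p; x = v does so directly. *)
Lemma pred_le P P' (v p q : T) :
  partition P ground -> noncrossing P -> partition P' ground ->
  (forall u, 0 < u -> tmax P u = tmax P' u) ->
  (forall a b : T, 0 < a -> a < b < v -> same P a b -> same P' a b) ->
  0 < p < v -> same P p v -> (forall t : T, t < v -> same P t v -> t <= p) ->
  0 < q < v -> same P' q v -> (forall t : T, t < v -> same P' t v -> t <= q) ->
  q <= p.
Proof.
move=> pP ncP pP' eqmax IH /andP[p0 pv] spv pmax /andP[q0 qv] sqv qmax.
rewrite leqNgt; apply/negP => pq.
have : ~~ tmax P q by rewrite eqmax // tmaxN; apply/exists_inP; exists v.
rewrite tmaxN => /exists_inP[x sqx qx].
have [xv|vx|xv] := ltngtP x v.
- have sqx' : same P' q x by apply: IH => //; rewrite qx.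
  have x0 : 0 < x by lia.
  have : same P' x v by apply: same_trans sqv => //; exact: same_sym sqx'.
  by move/(qmax _ xv); lia.
- have spq := noncrossing_same pP ncP p0 pq qv vx spv sqx.
  have : same P q v by apply: same_trans spv => //; exact: same_sym spq.
  by move/(pmax _ qv); lia.
- move/val_inj: xv => xv; rewrite xv in sqx.
  by have := pmax _ qv sqx; lia.
Qed.

(** By [pred_le] in both directions, v has the same predecessor in its two blocks; an earlier member
    u is tied to that predecessor by the agreement below v. *)
Lemma same_step P P' (u v : T) :
  partition P ground -> noncrossing P -> partition P' ground -> noncrossing P' ->
  (forall u, 0 < u -> tmin P u = tmin P' u) ->
  (forall u, 0 < u -> tmax P u = tmax P' u) ->
  (forall a b : T, 0 < a -> a < b < v -> same P a b = same P' a b) ->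
  0 < u < v -> same P u v -> same P' u v.
Proof.
move=> pP ncP pP' ncP' eqmin eqmax IH /andP[u0 uv] suv.
have v0 : 0 < v by lia.
have mv : ~~ tmin P v.
  by rewrite tminN; apply/exists_inP; exists u => //; exact: same_sym suv.
have mv' : ~~ tmin P' v by rewrite -eqmin.
have [p pv [sp pmax]] := tmin_pred pP v0 mv.
have [q qv [sq qmax]] := tmin_pred pP' v0 mv'.
have qp : q <= p.
  by apply: (pred_le pP ncP pP' eqmax) pv sp pmax qv sq qmax => a b a0 ab; rewrite IH.
have pq : p <= q.
  apply: (pred_le pP' ncP' pP) qv sq qmax pv sp pmax => [t t0|a b a0 ab].
    by rewrite eqmax.
  by rewrite IH.
have e : q = p by apply: val_inj; apply/eqP; rewrite eqn_leq qp.
rewrite e in sq.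
have [up|up] := eqVneq u p; first by rewrite up.
have ltup : u < p by rewrite ltn_neqAle -val_eqE in up *; rewrite up pmax.
have p0 : 0 < p by lia.
apply: same_trans sq => //; rewrite -IH //; last by rewrite ltup; case/andP: pv.
by apply: same_trans suv _ => //; exact: same_sym sp.
Qed.

Lemma same_inj P P' :
  partition P ground -> noncrossing P -> partition P' ground -> noncrossing P' ->
  (forall u, 0 < u -> tmin P u = tmin P' u) ->
  (forall u, 0 < u -> tmax P u = tmax P' u) -> P = P'.
Proof.
move=> pP ncP pP' ncP' eqmin eqmax.
have H m (u v : T) : v < m -> 0 < u < v -> same P u v = same P' u v.
  elim: m u v => // m IH u v vm uv.
  have IH' (a b : T) : 0 < a -> a < b < v -> same P a b = same P' a b.
    by move=> a0 ab; apply: IH; lia.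
  by apply/idP/idP; apply: same_step => //= *; rewrite ?eqmin ?eqmax ?IH'.
have {}H (u v : T) : 0 < u -> 0 < v -> same P u v = same P' u v.
  move=> u0 v0; have [uv|vu|/val_inj ->] := ltngtP u v.
  - by apply: (H n.+1); rewrite ?u0.
  - have sym Q : partition Q ground -> same Q u v = same Q v u.
      by move=> pQ; apply/idP/idP; exact: same_sym.
    by rewrite !sym //; apply: (H n.+1); rewrite ?v0.
  - by rewrite !same_refl.
rewrite -(equivalence_partition_pblock pP) -(equivalence_partition_pblock pP').
rewrite /equivalence_partition; apply: eq_in_imset => u; rewrite inE => u0.
by apply/setP => v; rewrite !inE; case v0: (0 < v); rewrite // H.
Qed.

Lemma encode_inj P P' :
  partition P ground -> noncrossing P -> partition P' ground -> noncrossing P' ->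
  encode P = encode P' -> P = P'.
Proof.
move=> pP ncP pP' ncP' e.
have E u : 0 < u -> (tmin P u, tmax P u) = (tmin P' u, tmax P' u).
  by case: (unliftP ord0 u) => [k|] eu; rewrite eu // => _; rewrite -!encodeE e.
by apply: same_inj => // u /E[].
Qed.

(** * Decoding as the inverse of the encoding *)

Section Decoding.
Variable w : n.-tuple letter.

Definition joinedb (u v : nat) := (level w u == level w v) &&
  [forall t : 'I_n, ((u < t <= v) || (v < t <= u)) ==> (level w u <= height 0 w t)].

Lemma joinedP (u v : nat) : u < n -> v < n -> reflect (joined w u v) (joinedb u v).
Proof.
move=> un vn; apply: (iffP andP) => [[/eqP e /forallP H]|[e H]].
  split=> // t tuv; have tn : t < n by lia.
  by have /implyP/(_ tuv) := H (Ordinal tn).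
by split; [exact/eqP | apply/forallP => t; apply/implyP; exact: H].
Qed.

Definition decode : {set {set T}} :=
  equivalence_partition (fun u v => joinedb u.-1 v.-1) ground.

Lemma pred_lt (u : T) : 0 < u -> u.-1 < n.
Proof. by have := ltn_ord u; lia. Qed.

Lemma joinedb_equiv :
  {in ground & &, equivalence_rel (fun u v : T => joinedb u.-1 v.-1)}.
Proof.
move=> u v t; rewrite !inE => /pred_lt u0 /pred_lt v0 /pred_lt t0; split=> /=.
  by apply/(joinedP t0 t0); exact: joined_refl.
move=> /(joinedP u0 v0) juv.
apply/(joinedP u0 t0)/(joinedP v0 t0) => j.
  exact: joined_trans (joined_sym juv) j.
exact: joined_trans juv j.
Qed.

Lemma decode_partition : partition decode ground.
Proof. exact: equivalence_partitionP joinedb_equiv. Qed.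

Lemma same_decodeP (u v : T) : 0 < u -> 0 < v ->
  reflect (joined w u.-1 v.-1) (same decode u v).
Proof.
move=> u0 v0; rewrite (pblock_equivalence_partition joinedb_equiv) ?inE //.
by apply: joinedP; exact: pred_lt.
Qed.

Lemma decode_noncrossing : noncrossing decode.
Proof.
apply: (noncrossing_intro decode_partition) => a b c e a0 ab bc ce.
have [b0 c0 e0] : [/\ 0 < b, 0 < c & 0 < e] by split; lia.
move=> /(same_decodeP a0 c0) jac /(same_decodeP b0 e0) jbe.
apply/same_decodeP => //; apply: joined_noncrossing jac jbe; lia.
Qed.

Hypothesis vw : valid 0 w.

Lemma decodeK : encode decode = w.
Proof.
apply: eq_from_tnth => k; rewrite tnth_mktuple (tnth_nth letter0).
set v := lift _ _; have v0 : 0 < v by [].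
have kw : k < size w by rewrite size_tuple.
have vk : v.-1 = k by [].
have E1 : ~~ tmin decode v = ~~ (nth letter0 w k).1.
  rewrite tminN; apply/exists_inP/idP => [[u suv uv]|/(joined_before vw kw)[u uk ju]].
    apply/(joined_before vw kw).
    have u0 := same_gt0 decode_partition v0 suv.
    exists u.-1; first by rewrite -vk; lia.
    by rewrite -vk; apply: joined_sym; exact/same_decodeP.
  have un : u < n by have := ltn_ord k; lia.
  exists (lift ord0 (Ordinal un)); last by rewrite /= /bump /=; lia.
  by apply/same_decodeP => //; exact: joined_sym.
have E2 : ~~ tmax decode v = ~~ (nth letter0 w k).2.
  rewrite tmaxN; apply/exists_inP/idP => [[u suv uv]|/(joined_after vw kw)[u]].
    apply/(joined_after vw kw).
    have u0 := same_gt0 decode_partition v0 suv.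
    exists u.-1; first by rewrite size_tuple pred_lt // andbT -vk; lia.
    by rewrite -vk; apply: joined_sym; exact/same_decodeP.
  rewrite size_tuple => /andP[ku un] ju.
  exists (lift ord0 (Ordinal un)); last by rewrite /= /bump /=; lia.
  by apply/same_decodeP => //; exact: joined_sym.
by rewrite (negb_inj E1) (negb_inj E2); case: nth.
Qed.

End Decoding.

(** By [decodeK] both sides have the same word, and [encode_inj] concludes. *)
Lemma encodeK P : partition P ground -> noncrossing P -> decode (encode P) = P.
Proof.
move=> pP ncP; have vw := encode_valid pP.
apply: encode_inj (decode_partition _) (decode_noncrossing _) pP ncP _.
exact: decodeK.
Qed.

Definition nc_partitions : {set {set {set T}}} :=
  [set P | partition P ground && noncrossing P].

Lemma big_nc_partitions (V : nmodType) (F : n.-tuple letter -> V) :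
  (\sum_(P in nc_partitions) F (encode P) = \sum_(w : n.-tuple letter | valid 0 w) F w)%R.
Proof.
rewrite [RHS](reindex_onto encode decode) => [|w vw]; last exact: decodeK.
apply: eq_bigl => P; rewrite inE; apply/idP/andP.
  by case/andP => pP ncP; rewrite encode_valid // encodeK.
by case=> _ /eqP <-; rewrite decode_partition decode_noncrossing.
Qed.

End Partitions.

(** * Special elements as special letters *)

Lemma nth_zones n i j k : (i + j <= n)%N -> (k < n)%N ->
  nth zone2 (zones n i j) k = ((k < i) || (n - j <= k), n - j <= k)%N.
Proof.
move=> lij kn; rewrite /zones !nth_cat !size_nseq !nth_nseq.
case: ltnP => ki; first by rewrite leqNgt (_ : k < n - j)%N //; lia.
case: ltnP => kj; first by rewrite leqNgt (_ : k < n - j)%N //; lia.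
have -> : (n - j <= k)%N by lia.
by have -> : (k - i - (n - i - j) < j)%N by lia.
Qed.

Lemma size_zones n i j : (i + j <= n)%N -> size (zones n i j) = n.
Proof. by move=> lij; rewrite !size_cat !size_nseq; lia. Qed.

Section Special.
Variables (n i j : nat) (P : {set {set 'I_n.+1}}).
Hypotheses (lij : i + j <= n) (pP : partition P (@ground n.+1)) (ncP : noncrossing P).
Notation w := (encode P).

(** The element 1 sits at position 0 with level 1, so being joined to it means having level 1 on a
    stack that has not emptied since. *)
Lemma contains_oneE (k : 'I_n) : ~~ (nth letter0 w k).1 ->
  contains_one (pblock P (lift ord0 k)) = flag 0 true w k && (height 0 w k == 1).
Proof.
move=> nonmin; set v := lift ord0 k.
have vw := encode_valid pP.
have n0 : 0 < n by have := ltn_ord k; lia.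
have l00 : level w 0 = 1.
  by have := valid_step vw (_ : 0 < size w); rewrite /level height0 size_tuple orbF => ->.
have lk : level w k = height 0 w k by rewrite /level (negPf nonmin) addn0.
pose one : 'I_n.+1 := lift ord0 (Ordinal n0).
have kw : k <= size w by rewrite size_tuple ltnW.
have -> : contains_one (pblock P v) = (v \in pblock P one).
  apply/exists_inP/idP => [[u uB /eqP u1]|sv].
    have -> : one = u by apply: val_inj; rewrite /= u1.
    exact: same_sym uB.
  by exists one => //; apply: same_sym sv.
rewrite -[in LHS](encodeK pP ncP).
apply/same_decodeP/andP => //; rewrite (_ : one.-1 = 0) // (_ : v.-1 = k) //.
  case=> e H.
  split; last by rewrite -lk -e l00.
  by apply/flagP => //; split=> // t tk; rewrite -l00 H //= tk.
case=> /flagP [//|_ H] /eqP hk; split=> [|t tk]; first by rewrite l00 lk hk.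
by rewrite l00; apply: H; lia.
Qed.

Lemma special_encode (k : 'I_n) : special i j P (lift ord0 k) =
  is_special (nth zone2 (zones n i j) k) (height 0 w k) (flag 0 true w k)
    (nth letter0 w k).
Proof.
set v := lift ord0 k; have v0 : 0 < v by [].
have BP := pblockP pP v0; have vB := same_refl pP v0.
have minE : is_min v (pblock P v) = tmin P v by rewrite /is_min vB.
have maxE : is_max v (pblock P v) = tmax P v by rewrite /is_max vB.
(* A block is a singleton exactly when v is both its minimum and its maximum, so the size conditions
   in [special] can be read off from the letter. *)
have setE : (pblock P v == [set v]) = (#|pblock P v| <= 1).
  by rewrite eq_sym eqEcard sub1set vB cards1.
have singE : (pblock P v == [set v]) = tmin P v && tmax P v.
  apply/eqP/andP => [e|[/forall_inP mn /forall_inP mx]].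
    by rewrite /tmin /tmax e; split; apply/forall_inP => u; rewrite inE => /eqP ->.
  apply/setP => u; rewrite inE; apply/idP/eqP => [uB|-> //].
  by apply: val_inj; apply/eqP; rewrite eqn_leq mn ?mx.
have -> : special i j P v = [|| tmin P v && (2 <= #|pblock P v|),
   (tmin P v && tmax P v) && ((v <= i) || (n.+1 - j <= v)) |
   [&& n.+1 - j <= v, ~~ tmin P v & tmax P v ==> contains_one (pblock P v)]].
  rewrite -singE -minE -maxE.
  apply/exists_inP/idP => [[B PB /andP[vB' H]]|H].
    by rewrite (same_block pP PB vB').
  by exists (pblock P v); rewrite // vB.
rewrite ltnNge -setE singE nth_zones // encodeE -/v.
have := @contains_oneE k; rewrite encodeE -/v /is_special /=.
have -> : (v <= i) = (k < i) by [].
have -> : (n.+1 - j <= v) = (n - j <= k) by rewrite subSn //; lia.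
case: tmin => /= [_|->] //; first by case: tmax; rewrite /= ?andbF ?orbF.
Qed.

Lemma nonspecial_encode :
  nonspecial (zones n i j) 0 true w + #|[set v | special i j P v]| = n.
Proof.
have s0 : special i j P ord0 = false.
  by apply/exists_inP => -[B PB /andP[vB _]]; have := block_gt0 pP PB vB.
have -> : #|[set v | special i j P v]| = \sum_(v < n.+1) special i j P v.
  by rewrite -sum1_card big_mkcond; apply: eq_bigr => v _; rewrite inE; case: special.
rewrite nonspecialE size_zones ?size_tuple // big_ord_recl s0 add0n.
rewrite -big_split /= -[RHS](card_ord n) -sum1_card.
by apply: eq_bigr => k _; rewrite special_encode; case: is_special.
Qed.

End Special.

(** * Extraction of the coefficients *)

Local Open Scope ring_scope.

(** The factor x in [toric_contrib_closed_form] raises the exponent by one from the number of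
    nonspecial elements, which is n minus the number of special ones. *)
Lemma toric_contrib_nc n i j : (0 < i)%N || (j == 0%N) -> (i + j <= n)%N ->
  toric_contrib n.+1 i j =
  \sum_(P in nc_partitions n) 'X^(n.+1 - #|[set v | special i j P v]|).
Proof.
move=> ij lij; rewrite toric_contrib_closed_form -wsum_zones //.
rewrite -wsum_words size_zones // -big_nc_partitions mulr_sumr.
apply: eq_bigr => P; rewrite inE => /andP[pP ncP]; rewrite -exprS.
by congr ('X^ _); have := nonspecial_encode lij pP ncP; lia.
Qed.

Theorem theorem5p5 (d i j : nat) (hd : (2 <= d)%N) (hj : (j < d - 1)%N)
    (hij : (i = 0%N /\ j = 0%N) \/ ((1 <= i)%N /\ (i + j <= d - 1)%N))
    (m : int) :
  coefz (toric_contrib d i j) (d%:Z - m) = #|nc_with d i j m|%:R.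
Proof.
case: d hd hj hij => [//|n] _ _; rewrite subn1 /= => hij.
have ij : (0 < i)%N || (j == 0%N) by lia.
have lij : (i + j <= n)%N by lia.
pose sp (P : {set {set 'I_n.+1}}) := #|[set v | special i j P v]|.
(* This bound keeps the exponent [n.+1 - sp P] free of truncation. *)
have sp_le P : P \in nc_partitions n -> (sp P <= n)%N.
  rewrite inE => /andP[pP ncP].
  exact: leq_trans (leq_addl _ _) (eq_leq (nonspecial_encode lij pP ncP)).
have cardE : #|nc_with n.+1 i j m| =
    (\sum_(P in nc_partitions n) ((sp P)%:Z == m))%N.
  rewrite -sum1_card big_mkcond [RHS]big_mkcond; apply: eq_bigr => P _.
  by rewrite !inE andbA; case: (partition P _ && noncrossing P); case: (_ == m).
rewrite cardE natr_sum toric_contrib_nc //.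
case em: (n.+1%:Z - m) => [e|e] /=.
  rewrite coef_sum; apply: eq_bigr => P ncP; rewrite coefXn.
  have le_sp := sp_le P ncP; congr (nat_of_bool _)%:R.
  by apply/eqP/eqP; rewrite -/(sp P); lia.
(* A negative exponent means m > n + 1, more than the number of elements, so both sides are 0. *)
rewrite big1 // => P ncP; case: eqP => // spm.
by have := sp_le P ncP; lia.
Qed.
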